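(* Let $X$ be an infinite set, and let $\mathbf{S}_X=\langle\overline{X}\rangle$ be the subalgebra of the left-handed skew Boolean intersection algebra $\mathbf{S}_\Omega$ generated by $\overline{X}=\{i(x)\colon x\in X\}$, where $i(x)=\{(X,\alpha,A)\in\Omega\colon x\in\mathrm{dom}(\alpha)\text{ and }x\in A\}$. Then $\mathbf{S}_X$ is freely generated by $\overline{X}$ (as a left-handed skew Boolean intersection algebra).
   Context: A skew Boolean algebra (SBA) is an algebra $(S;\wedge,\vee,\setminus,0)$ of type $(2,2,2,0)$ satisfying: $\wedge$ and $\vee$ are associative; $x\vee(x\wedge y)=x=(y\wedge x)\vee x$ and $x\wedge(x\vee y)=x=(y\vee x)\wedge x$; $x\wedge(y\vee z)=(x\wedge y)\vee(x\wedge z)$ and $(y\vee z)\wedge x=(y\wedge x)\vee(z\wedge x)$; $x\vee 0=0\vee x=x$ and $x\wedge 0=0\wedge x=0$; $(x\setminus y)\wedge y=y\wedge(x\setminus y)=0$ and $(x\setminus y)\vee(x\wedge y\wedge x)=x=(x\wedge y\wedge x)\vee(x\setminus y)$; $x\wedge y\wedge z\wedge t=x\wedge z\wedge y\wedge t$. It is left-handed if also $x\wedge y\wedge x=x\wedge y$ and $x\vee y\vee x=y\vee x$. The natural partial order is: $x\leq y$ iff $x\wedge y=y\wedge x=x$. An SBA has intersections if any two elements $x,y$ have a greatest lower bound $x\sqcap y$ with respect to $\leq$; a (left-handed) skew Boolean intersection algebra (SBIA) is an algebra $(S;\wedge,\vee,\setminus,\sqcap,0)$ where $(S;\wedge,\vee,\setminus,0)$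 is a (left-handed) SBA with intersections and $\sqcap$ is this meet operation. Left-handed SBIAs form a variety in the signature $(\wedge,\vee,\setminus,\sqcap,0)$; ''freely generated'' refers to this variety, and subalgebras are taken in this signature. Construction of $\mathbf{S}_\Omega$. A partition is a partition into non-empty blocks, $\mathrm{dom}(\alpha)$ is the set partitioned by $\alpha$, and $A\in\alpha$ means $A$ is a block. Let $\mathcal{X}$ be the set of all pairs $(X,\alpha)$ with $\alpha$ a partition of a non-empty subset of $X$ (arbitrary, possibly infinite), let $\Omega=\{(X,\alpha,A)\colon(X,\alpha)\in\mathcal{X},\ A\in\alpha\}$, and let $p\colon\Omega\to\mathcal{X}$, $p(X,\alpha,A)=(X,\alpha)$. Let $\mathbf{S}_\Omega$ be the collection of all subsets $U\subseteq\Omega$ such that $p|_U$ is injective. On $\mathbf{S}_\Omega$ define $U\wedge V=\{(X,\alpha,A)\in U\colon(X,\alpha)\in p(U)\cap p(V)\}$; $U\setminus V=\{(X,\alpha,A)\in U\colon(X,\alpha)\in p(U)\text{ and }(X,\alpha)\notin p(V)\}$; $U\vee V=(U\setminus V)\cup V$ (with $\setminus$ the operation just defined); $U\sqcap V=U\cap V$. Then $(\mathbf{S}_\Omega;\wedge,\vee,\setminus,\sqcap,\varnothing)$ is a left-handed SBIA, with zero $\varnothing$, and each $i(x)$ belongs to $\mathbf{S}_\Omega$; the map $x\mapsto i(x)$ is injective. *)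

(* Defs.v *)
From mathcomp Require Import all_boot.
From mathcomp Require Import mathcomp_extra boolp classical_sets functions.
From mathcomp Require Import cardinality.

Set Implicit Arguments.
Unset Strict Implicit.
Unset Printing Implicit Defensive.

Local Open Scope classical_set_scope.

(* The signature (meet, join, diff, cap, zero) of type (2,2,2,2,0); the laws
   are imposed separately, by the predicate [left_handed_SBIA]. *)
Record algebra := Algebra {
  carrier :> Type;
  meet : carrier -> carrier -> carrier;
  join : carrier -> carrier -> carrier;
  diff : carrier -> carrier -> carrier;
  cap : carrier -> carrier -> carrier;
  zero : carrier }.

Arguments zero {_}.

Declare Scope sbia_scope.
Delimit Scope sbia_scope with sbia.
Notation "x ∧ y" := (meet x y) (at level 40, left associativity) : sbia_scope.
Notation "x ∨ y" := (join x y) (at level 50, left associativity) : sbia_scope.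
Notation "x ∖ y" := (diff x y) (at level 40, left associativity) : sbia_scope.
Notation "x ⊓ y" := (cap x y) (at level 40, left associativity) : sbia_scope.
Local Open Scope sbia_scope.

Record skew_boolean (S : algebra) : Prop := SkewBoolean {
  meetA : forall x y z : S, x ∧ (y ∧ z) = (x ∧ y) ∧ z;
  joinA : forall x y z : S, x ∨ (y ∨ z) = (x ∨ y) ∨ z;
  joinKl : forall x y : S, x ∨ (x ∧ y) = x;
  joinKr : forall x y : S, (y ∧ x) ∨ x = x;
  meetKl : forall x y : S, x ∧ (x ∨ y) = x;
  meetKr : forall x y : S, (y ∨ x) ∧ x = x;
  meet_joinr : forall x y z : S, x ∧ (y ∨ z) = (x ∧ y) ∨ (x ∧ z);
  meet_joinl : forall x y z : S, (y ∨ z) ∧ x = (y ∧ x) ∨ (z ∧ x);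
  join_zero : forall x : S, x ∨ zero = x;
  zero_join : forall x : S, zero ∨ x = x;
  meet_zero : forall x : S, x ∧ zero = zero;
  zero_meet : forall x : S, zero ∧ x = zero;
  diff_meet : forall x y : S, (x ∖ y) ∧ y = zero;
  meet_diff : forall x y : S, y ∧ (x ∖ y) = zero;
  diff_join : forall x y : S, (x ∖ y) ∨ (x ∧ y ∧ x) = x;
  join_diff : forall x y : S, (x ∧ y ∧ x) ∨ (x ∖ y) = x;
  meet_normal : forall x y z t : S, x ∧ y ∧ z ∧ t = x ∧ z ∧ y ∧ t }.

Definition left_handed (S : algebra) : Prop :=
  (forall x y : S, x ∧ y ∧ x = x ∧ y) /\ (forall x y : S, x ∨ y ∨ x = y ∨ x).

Definition natural_le (S : algebra) (x y : S) : Prop :=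
  x ∧ y = x /\ y ∧ x = x.

Definition is_glb (S : algebra) (x y m : S) : Prop :=
  [/\ natural_le m x, natural_le m y &
      forall z, natural_le z x -> natural_le z y -> natural_le z m].

Record left_handed_SBIA (S : algebra) : Prop := LeftHandedSBIA {
  sbia_skew_boolean : skew_boolean S;
  sbia_left_handed : left_handed S;
  sbia_cap_glb : forall x y : S, is_glb x y (x ⊓ y) }.

Record is_hom (S T : algebra) (h : S -> T) : Prop := IsHom {
  hom_meet : forall x y, h (x ∧ y) = h x ∧ h y;
  hom_join : forall x y, h (x ∨ y) = h x ∨ h y;
  hom_diff : forall x y, h (x ∖ y) = h x ∖ h y;
  hom_cap : forall x y, h (x ⊓ y) = h x ⊓ h y;
  hom_zero : h zero = zero }.

Record subalgebra (S : algebra) (B : set S) : Prop := Subalgebra {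
  sub_meet : forall x y, B x -> B y -> B (x ∧ y);
  sub_join : forall x y, B x -> B y -> B (x ∨ y);
  sub_diff : forall x y, B x -> B y -> B (x ∖ y);
  sub_cap : forall x y, B x -> B y -> B (x ⊓ y);
  sub_zero : B zero }.

Definition generated (S : algebra) (G : set S) : set S :=
  smallest (@subalgebra S) G.

Lemma generated_subalgebra (S : algebra) (G : set S) :
  subalgebra (generated G).
Proof.
split; last by move=> B [/sub_zero].
- by move=> x y xG yG B GB; apply: sub_meet (xG B GB) (yG B GB); case: GB.
- by move=> x y xG yG B GB; apply: sub_join (xG B GB) (yG B GB); case: GB.
- by move=> x y xG yG B GB; apply: sub_diff (xG B GB) (yG B GB); case: GB.
- by move=> x y xG yG B GB; apply: sub_cap (xG B GB) (yG B GB); case: GB.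
Qed.

Definition subalg (S : algebra) (B : set S) (HB : subalgebra B) : algebra :=
  @Algebra (set_type B)
    (fun u v => SigSub (mem_set (sub_meet HB (set_valP u) (set_valP v))))
    (fun u v => SigSub (mem_set (sub_join HB (set_valP u) (set_valP v))))
    (fun u v => SigSub (mem_set (sub_diff HB (set_valP u) (set_valP v))))
    (fun u v => SigSub (mem_set (sub_cap HB (set_valP u) (set_valP v))))
    (SigSub (mem_set (sub_zero HB))).

Definition freely_generated (V : algebra -> Prop) (F : algebra) (G : set F) :
    Prop :=
  [/\ V F, generated G = [set: F] &
      forall T : algebra, V T -> forall f : set_type G -> T,
        exists! h : F -> T, is_hom h /\ forall g : set_type G, h (val g) = f g].

Section SOmega.
Variable X : Type.
Implicit Types (U V : set (set (set X) * set X)).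

Definition dom (alpha : set (set X)) : set X := cover alpha id.

(* The ground set X is fixed, so the pair (X, alpha) is encoded by alpha and
   the triple (X, alpha, A) by the pair (alpha, A). *)
Definition calX : set (set (set X)) :=
  [set alpha | exists2 D : set X, D !=set0 & partition alpha id D].

Definition Omega : set (set (set X) * set X) :=
  [set w | calX w.1 /\ w.1 w.2].

Definition p (w : set (set X) * set X) : set (set X) := w.1.

Definition section_set : set (set (set (set X) * set X)) :=
  [set U | U `<=` Omega /\ set_inj U p].

Definition omega_meet U V := [set w | U w /\ (p @` U `&` p @` V) (p w)].
Definition omega_diff U V := [set w | U w /\ (p @` U `\` p @` V) (p w)].
Definition omega_join U V := omega_diff U V `|` V.

Lemma section_subset U V : V `<=` U -> section_set U -> section_set V.
Proof.
move=> VU [UO Uinj]; split; first exact: subset_trans UO.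
by move=> w w' /set_mem/VU/mem_set wU /set_mem/VU/mem_set w'U; apply: Uinj.
Qed.

Lemma section_meet U V :
  section_set U -> section_set V -> section_set (omega_meet U V).
Proof. by move=> HU _; apply: section_subset HU => w []. Qed.

Lemma section_diff U V :
  section_set U -> section_set V -> section_set (omega_diff U V).
Proof. by move=> HU _; apply: section_subset HU => w []. Qed.

Lemma section_join U V :
  section_set U -> section_set V -> section_set (omega_join U V).
Proof.
move=> HU HV; have [DO Dinj] := section_diff HU HV; have [VO Vinj] := HV.
split; first by move=> w [/DO|/VO].
move=> w w' /set_mem[wD|wV] /set_mem[w'D|w'V] e.
- by apply: Dinj; rewrite ?in_setE.
- by case: wD => _ [_ []]; exists w'.
- by case: w'D => _ [_ []]; exists w.
- by apply: Vinj; rewrite ?in_setE.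
Qed.

Lemma section_cap U V :
  section_set U -> section_set V -> section_set (U `&` V).
Proof. by move=> HU _; apply: section_subset HU => w []. Qed.

Lemma section_zero : section_set set0.
Proof. by split=> [w []|w w' /set_mem[]]. Qed.

Definition S_Omega : algebra :=
  @Algebra (set_type section_set)
    (fun u v => SigSub (mem_set (section_meet (set_valP u) (set_valP v))))
    (fun u v => SigSub (mem_set (section_join (set_valP u) (set_valP v))))
    (fun u v => SigSub (mem_set (section_diff (set_valP u) (set_valP v))))
    (fun u v => SigSub (mem_set (section_cap (set_valP u) (set_valP v))))
    (SigSub (mem_set section_zero)).

Definition i_set (x : X) : set (set (set X) * set X) :=
  [set w | [/\ Omega w, dom w.1 x & w.2 x]].

Lemma section_i (x : X) : section_set (i_set x).
Proof.
split=> [w []//|[a A] [b B]] /set_mem[[[D _ [_ aP _]] /= aA] _ /= Ax].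
move=> /set_mem[[_ /= bB] _ /= Bx] /= e; rewrite /p /= in e; subst b.
by rewrite (aP A B) //; exists x.
Qed.

Definition i (x : X) : S_Omega := SigSub (mem_set (section_i x)).

Definition Xbar : set S_Omega := range i.

Definition S_X : algebra := subalg (generated_subalgebra Xbar).

Definition Xbar_in_S_X : set S_X :=
  [set u | Xbar (val (u : set_type (generated Xbar)))].

End SOmega.

Arguments calX : clear implicits.
Arguments Omega : clear implicits.
Arguments section_set : clear implicits.
Arguments Xbar : clear implicits.
Arguments Xbar_in_S_X : clear implicits.

(* Main.v *)
(** Two distinct elements of a left-handed SBIA [T] are separated by a maximal
    filter [F] of [T] for the preorder [x ∧ y = x].  Such an [F] turns [T] into
    a primitive algebra: the elements outside [F] collapse to [0], and those of
    [F] are identified when they have a common lower bound in [F].  Given a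
    family [g : X -> T], this identification partitions [{x | g x \in F}], and
    evaluation at that point of [calX] relates the value of a term in [S_Omega]
    at [i] to its value in [T] at [g].  Hence an identity that holds in [S_X]
    at the generators holds in [T] at [g]. *)
Require Import Defs.
From mathcomp Require Import all_boot.
From mathcomp Require Import mathcomp_extra boolp classical_sets functions.
From mathcomp Require Import cardinality.

Set Implicit Arguments.
Unset Strict Implicit.
Unset Printing Implicit Defensive.

Local Open Scope classical_set_scope.
Local Open Scope sbia_scope.

(** * Natural order and meets in a left-handed SBIA *)

Section LeftHandedSBIA.
Variables (T : algebra) (T_SBIA : left_handed_SBIA T).
Implicit Types x y z w : T.

Let T_SBA := sbia_skew_boolean T_SBIA.

Lemma meet_idem x : x ∧ x = x.
Proof. by rewrite -{2}(joinKl T_SBA x x) (meetKl T_SBA). Qed.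

Lemma meetKlh x y : x ∧ y ∧ x = x ∧ y.
Proof. by case: (sbia_left_handed T_SBIA). Qed.

(** Left-handedness allows [x] to be appended on the right; normality then swaps the two factors
    enclosed between copies of [x]. *)
Lemma meetACr x y z : x ∧ y ∧ z = x ∧ z ∧ y.
Proof.
have lh u v : x ∧ u ∧ v ∧ x = x ∧ u ∧ v.
  by rewrite -(meetA T_SBA x u v) meetKlh.
by rewrite -[LHS]lh (meet_normal T_SBA) lh.
Qed.

Lemma natural_le_refl x : natural_le x x.
Proof. by split; exact: meet_idem. Qed.

Lemma natural_le_trans y x z :
  natural_le x y -> natural_le y z -> natural_le x z.
Proof.
move=> [xy yx] [yz zy]; split.
  by rewrite -{1}xy -(meetA T_SBA) yz.
by rewrite -{1}yx (meetA T_SBA) zy.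
Qed.

Lemma natural_le_anti x y : natural_le x y -> natural_le y x -> x = y.
Proof. by move=> [xy _] [_ yx]; rewrite -xy. Qed.

Lemma meet_le x y : natural_le (x ∧ y) x.
Proof.
by split; [exact: meetKlh | rewrite (meetA T_SBA) meet_idem].
Qed.

(** By left-handedness [x ∨ y = y ∨ x ∨ y], to which absorption applies. On the left operand only
    [x ∖ y] is sure to lie below the join. *)
Lemma join_ge x y : natural_le y (x ∨ y).
Proof.
split; last exact: meetKr.
have [_ lhj] := sbia_left_handed T_SBIA.
by rewrite -lhj -(joinA T_SBA) (meetKl T_SBA).
Qed.

Lemma diff_le x y : natural_le (x ∖ y) x.
Proof.
split.
  by rewrite -{2}(diff_join T_SBA x y) (meetKl T_SBA).
by rewrite -{1}(join_diff T_SBA x y) (meetKr T_SBA).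
Qed.

Lemma diff_le_join x y : natural_le (x ∖ y) (x ∨ y).
Proof.
have [dx xd] := diff_le x y; split.
  by rewrite (meet_joinr T_SBA) dx (diff_meet T_SBA) (join_zero T_SBA).
by rewrite (meet_joinl T_SBA) xd (meet_diff T_SBA) (join_zero T_SBA).
Qed.

(** Elements with a common upper bound commute: [x ∧ y = z ∧ x ∧ y = z ∧ y ∧ x = y ∧ x]. *)
Lemma meet_le_bound x y z : natural_le x z -> natural_le y z ->
  natural_le (x ∧ y) y.
Proof.
move=> [xz zx] [yz zy]; suff -> : x ∧ y = y ∧ x by exact: meet_le.
by rewrite -{1}zx meetACr zy.
Qed.

Lemma diff_eq0 x y : x ∖ y = Defs.zero -> x ∧ y = x.
Proof.
move=> xy0; have := diff_join T_SBA x y.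
by rewrite xy0 (zero_join T_SBA) meetKlh.
Qed.

Lemma cap_lel x y : natural_le (x ⊓ y) x.
Proof. by case: (sbia_cap_glb T_SBIA x y). Qed.

Lemma cap_ler x y : natural_le (x ⊓ y) y.
Proof. by case: (sbia_cap_glb T_SBIA x y). Qed.

Lemma cap_glb x y z : natural_le z x -> natural_le z y -> natural_le z (x ⊓ y).
Proof. by case: (sbia_cap_glb T_SBIA x y) => _ _; apply. Qed.

Lemma diff_cap_eq0 x y : x ∖ (x ⊓ y) = Defs.zero -> natural_le x y.
Proof.
move=> /diff_eq0 e; suff -> : x = x ⊓ y by exact: cap_ler.
by rewrite -{1}e; case: (cap_lel x y).
Qed.

(** * Maximal filters *)

Record maximal_filter (F : set T) : Prop := MaximalFilter {
  filter_meet : forall x y, F x -> F y -> F (x ∧ y);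
  filter_up : forall x y, x ∧ y = x -> F x -> F y;
  filter_zero : ~ F Defs.zero;
  filter_max : forall y, ~ F y -> exists2 x, F x & x ∧ y = Defs.zero }.

Lemma maximal_filter_exists c : c <> Defs.zero ->
  exists2 F, maximal_filter F & F c.
Proof.
move=> c0.
(* The empty chain of [Zorn_bigcup] is why the empty set is allowed here. *)
pose P (F : set T) := [/\ forall x y, F x -> F y -> F (x ∧ y),
  forall x y, x ∧ y = x -> F x -> F y, ~ F Defs.zero & F !=set0 -> F c].
have [C CP Ctot|F [[FI Fup F0 Fc] Fmax]] := @Zorn_bigcup T P.
  split.
  - move=> x y [A CA Ax] [B CB By]; have [AB|BA] := Ctot A B CA CB.
    + by exists B => //; have [BI _ _ _] := CP B CB; apply: BI => //; apply: AB.
    + by exists A => //; have [AI _ _ _] := CP A CA; apply: AI => //; apply: BA.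
  - move=> x y xy [A CA Ax]; exists A => //.
    by have [_ Aup _ _] := CP A CA; apply: Aup Ax.
  - by move=> [A CA A0]; have [_ _ + _] := CP A CA; apply.
  - move=> [x [A CA Ax]]; exists A => //.
    by have [_ _ _] := CP A CA; apply; exists x.
(* An empty [F] would be properly contained in the principal filter of [c]. *)
have{}Fc : F c.
  apply: contrapT => nFc; have F_empty x : ~ F x.
    by move=> Fx; apply: nFc; apply: Fc; exists x.
  apply: (Fmax [set x | c ∧ x = c]).
    split=> [x /F_empty|sub] //.
    by apply: (F_empty c); apply: sub; exact: meet_idem.
  split=> /=.
  - by move=> x y cx cy; rewrite (meetA T_SBA) cx.
  - by move=> x y xy cx; rewrite -{1}cx -(meetA T_SBA) xy.
  - by rewrite (meet_zero T_SBA) => /esym/c0.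
  - by move=> _; exact: meet_idem.
exists F => //; split=> // y nFy; apply: contrapT => no_x.
(* The filter generated by [F] and [y]: it is proper when no member of [F] has zero meet with [y],
   which contradicts the maximality of [F]. *)
pose B := [set z | exists2 x, F x & x ∧ y ∧ z = x ∧ y].
apply: (Fmax B).
  split=> [z Fz|sub]; first by exists z => //; rewrite meetKlh.
  by apply: nFy; apply: sub; exists c => //; rewrite -(meetA T_SBA) meet_idem.
split.
- move=> z z' [x Fx xz] [x' Fx' xz']; exists (x ∧ x'); first exact: FI.
  rewrite (meetA T_SBA) (meetACr _ _ y).
  rewrite (meetACr _ x') xz -(meetACr x x') -(meetA T_SBA x) -(meetA T_SBA x).
  by rewrite xz'.
- move=> z z' zz' [x Fx xz]; exists x => //.
  by rewrite -{1}xz -(meetA T_SBA) zz'.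
- move=> [x Fx]; rewrite (meet_zero T_SBA) => /esym xy0.
  by apply: no_x; exists x.
- move=> _; exists c => //; exact: meetKlh.
Qed.

(** * The primitive quotient defined by a maximal filter *)

Section MaximalFilter.
Variables (F : set T) (F_max : maximal_filter F).

Lemma filter_meetE x y : F (x ∧ y) <-> F x /\ F y.
Proof.
split=> [Fxy|[Fx Fy]]; last exact: filter_meet.
split; apply: (filter_up F_max _ Fxy); first exact: meetKlh.
by rewrite -(meetA T_SBA) meet_idem.
Qed.

(** Maximal filters are prime: if [a] and [b] in [F] annihilate [x] and [y], then [a ∧ b]
    annihilates [x ∨ y]. *)
Lemma filter_joinE x y : F (x ∨ y) <-> F x \/ F y.
Proof.
split=> [Fxy|[|]]; last 2 first.
- by apply: (filter_up F_max); exact: meetKl.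
- by apply: (filter_up F_max); case: (join_ge x y).
apply: contrapT => /not_orP[/(filter_max F_max)[a Fa ax0]].
move=> /(filter_max F_max)[b Fb by0]; apply: (filter_zero F_max).
have := filter_meet F_max (filter_meet F_max Fa Fb) Fxy.
rewrite (meet_joinr T_SBA) (meetACr a) ax0 (zero_meet T_SBA).
by rewrite -(meetA T_SBA) by0 (meet_zero T_SBA) (join_zero T_SBA).
Qed.

Lemma filter_diffE x y : F (x ∖ y) <-> F x /\ ~ F y.
Proof.
split=> [Fd|[Fx nFy]].
  split; first by apply: (filter_up F_max _ Fd); case: (diff_le x y).
  move=> /(filter_meet F_max Fd); rewrite (diff_meet T_SBA).
  exact: filter_zero.
move: Fx; rewrite -{1}(diff_join T_SBA x y) => /filter_joinE[//|].
by move=> /filter_meetE[/filter_meetE[]].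
Qed.

(** A partial equivalence relation with domain [F], since the common lower bound has to lie in
    [F]. *)
Definition filter_eq x y := exists w, [/\ F w, natural_le w x & natural_le w y].

Lemma filter_eq_refl x : F x -> filter_eq x x.
Proof. by exists x; split=> //; exact: natural_le_refl. Qed.

Lemma filter_eq_sym x y : filter_eq x y -> filter_eq y x.
Proof. by move=> [w [Fw wx wy]]; exists w. Qed.

Lemma filter_eq_mem x y : filter_eq x y -> F x.
Proof. by move=> [w [Fw [wx _] _]]; apply: filter_up Fw. Qed.

(** The two witnesses lie below [y], hence commute, and their meet is below both. *)
Lemma filter_eq_trans y x z : filter_eq x y -> filter_eq y z -> filter_eq x z.
Proof.
move=> [v [Fv vx vy]] [w [Fw wy wz]]; exists (v ∧ w); split.
- exact: filter_meet.
- exact: natural_le_trans (meet_le v w) vx.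
- exact: natural_le_trans (meet_le_bound vy wy) wz.
Qed.

Lemma filter_le_eq x y : F x -> natural_le x y -> filter_eq x y.
Proof. by move=> Fx xy; exists x; split=> //; exact: natural_le_refl. Qed.

Lemma filter_eq_congr x y z : filter_eq x y -> filter_eq z x <-> filter_eq z y.
Proof.
move=> xy; split=> zx; first exact: filter_eq_trans zx xy.
exact: filter_eq_trans zx (filter_eq_sym xy).
Qed.

Lemma filter_eq_memr x y : filter_eq x y -> F y.
Proof. by move=> /filter_eq_sym/filter_eq_mem. Qed.

(** This equivalence and those for [∖], [∨] and [⊓] have the same shape as the pointwise description
    of the operations of [S_Omega], with [F] in the role of the image under [p]. *)
Lemma filter_eq_meetE z x y :
  filter_eq z (x ∧ y) <-> filter_eq z x /\ F y.
Proof.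
have key : F x -> F y -> filter_eq (x ∧ y) x.
  by move=> Fx Fy; apply: filter_le_eq (meet_le x y); apply: filter_meet.
split=> [zxy|[zx Fy]].
  have [Fx Fy] := (filter_meetE x y).1 (filter_eq_memr zxy).
  by split=> //; apply/(filter_eq_congr _ (key Fx Fy)).
exact/(filter_eq_congr _ (key (filter_eq_memr zx) Fy)).
Qed.

Lemma filter_eq_diffE z x y :
  filter_eq z (x ∖ y) <-> filter_eq z x /\ ~ F y.
Proof.
have key : F x -> ~ F y -> filter_eq (x ∖ y) x.
  by move=> Fx Fy; apply: filter_le_eq (diff_le x y); apply/filter_diffE.
split=> [zxy|[zx Fy]].
  have [Fx Fy] := (filter_diffE x y).1 (filter_eq_memr zxy).
  by split=> //; apply/(filter_eq_congr _ (key Fx Fy)).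
exact/(filter_eq_congr _ (key (filter_eq_memr zx) Fy)).
Qed.

(** The join is identified with [y] if [y] is in [F], and with [x ∖ y] if only [x] is. *)
Lemma filter_eq_joinE z x y :
  filter_eq z (x ∨ y) <-> (filter_eq z x /\ ~ F y) \/ filter_eq z y.
Proof.
have [Fy|nFy] := EM (F y).
  have key : filter_eq y (x ∨ y) := filter_le_eq Fy (join_ge x y).
  by rewrite -(filter_eq_congr z key); split; [right | case=> [[]|]].
have nzy : ~ filter_eq z y by move=> /filter_eq_memr.
have dP : F x -> filter_eq (x ∖ y) (x ∨ y).
  by move=> Fx; apply: filter_le_eq (diff_le_join x y); apply/filter_diffE.
rewrite -filter_eq_diffE; split=> [zxy|[zd|//]].
  have [Fx|//] := (filter_joinE x y).1 (filter_eq_memr zxy).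
  by left; apply/(filter_eq_congr _ (dP Fx)).
apply/(filter_eq_congr _ (dP _)) => //.
by have /filter_diffE[] := filter_eq_memr zd.
Qed.

Lemma filter_capE x y : F (x ⊓ y) <-> filter_eq x y.
Proof.
split=> [Fxy|[w [Fw wx wy]]].
  by exists (x ⊓ y); split=> //; [exact: cap_lel | exact: cap_ler].
by apply: (filter_up F_max _ Fw); case: (cap_glb wx wy).
Qed.

Lemma filter_eq_capE z x y :
  filter_eq z (x ⊓ y) <-> filter_eq z x /\ filter_eq z y.
Proof.
split=> [zxy|[zx zy]].
  have Fxy := filter_eq_memr zxy.
  by split; apply: filter_eq_trans zxy (filter_le_eq Fxy _);
    [exact: cap_lel | exact: cap_ler].
have /filter_capE Fxy := filter_eq_trans (filter_eq_sym zx) zy.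
apply: filter_eq_trans zx (filter_eq_sym _).
exact: filter_le_eq Fxy (cap_lel x y).
Qed.

End MaximalFilter.

(** If [z] is not below [z'], then [z ∖ (z ⊓ z')] is nonzero; a maximal filter containing it
    contains [z] but not [z ⊓ z'], so it does not identify [z] with [z']. *)
Lemma maximal_filter_separates x y :
  (forall F, maximal_filter F ->
     (F x -> filter_eq F x y) /\ (F y -> filter_eq F y x)) -> x = y.
Proof.
have le_of z z' : (forall F, maximal_filter F -> F z -> filter_eq F z z') ->
    natural_le z z'.
  move=> sep; apply: diff_cap_eq0; apply: contrapT.
  move=> /maximal_filter_exists[F F_max /(filter_diffE F_max)[Fz]].
  by apply; apply/(filter_capE F_max); exact: sep.
by move=> sep; apply: natural_le_anti; apply: le_of => F /sep[].
Qed.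

(** * Evaluation at the partition given by a maximal filter *)

Section Evaluation.
Variables (X : Type) (g : X -> T) (F : set T) (F_max : maximal_filter F).
Implicit Types U V : set (set (set X) * set X).

Definition filter_block (a : X) : set X := [set b | filter_eq F (g a) (g b)].

Definition filter_partition : set (set X) :=
  [set A | exists2 a, F (g a) & A = filter_block a].

(** The first clause forces each block of [U] over [filter_partition] to be a [filter_block]. The
    last one may fail for an arbitrary [t] in [F], but it is inherited by terms in the [g a]; it
    ensures that [U] has a block over that point whenever [t] is in [F]. *)
Definition agrees_at_filter U (t : T) : Prop :=
  [/\ U `<=` Omega X,
      forall a, U (filter_partition, filter_block a) <-> filter_eq F (g a) t &
      F t -> exists a, filter_eq F (g a) t].

(** The hypothesis on [a] makes the partitioned set nonempty, as [calX] demands. *)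
Lemma filter_partition_cal (a : X) : F (g a) -> calX X filter_partition.
Proof.
move=> Fa; exists [set b | F (g b)]; first by exists a.
split.
- rewrite eqEsubset; split=> [b [_ [b' _ ->] bb']|b Fb].
    exact: filter_eq_memr bb'.
  by exists (filter_block b); [exists b | exact: filter_eq_refl].
- move=> _ _ [b Fb ->] [b' Fb' ->] [d [bd b'd]]; apply/seteqP.
  have bb' := filter_eq_trans F_max bd (filter_eq_sym b'd).
  split=> d'; last exact: filter_eq_trans.
  exact: (filter_eq_trans F_max (filter_eq_sym bb')).
- by move=> _ [b Fb ->]; exists b; exact: filter_eq_refl.
Qed.

Lemma agrees_image U t :
  agrees_at_filter U t -> (@p X @` U) filter_partition <-> F t.
Proof.
move=> [UO Ut tU]; split=> [[[al A] UA]|/tU[a /Ut Ua]]; last first.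
  by exists (filter_partition, filter_block a).
rewrite /p /= => e; subst al.
have [_ /= [a _ e]] := UO _ UA; rewrite e in UA.
exact: filter_eq_memr ((Ut a).1 UA).
Qed.

Lemma agrees_i (a : X) : agrees_at_filter (i_set a) (g a).
Proof.
split=> [w []//|b|Fa]; last by exists a; exact: filter_eq_refl.
split=> [[_ _]//|ba]; have Fb := filter_eq_mem F_max ba.
by do ![split] => //=; [exact: filter_partition_cal Fb | exists b |
  exists (filter_block b) => //; exists b].
Qed.

Lemma agrees_meet U V s t : agrees_at_filter U s -> agrees_at_filter V t ->
  agrees_at_filter (omega_meet U V) (s ∧ t).
Proof.
move=> Us Vt; have [UO UE sU] := Us; split=> [w [/UO]//|a|].
  rewrite (filter_eq_meetE F_max) -UE -(agrees_image Vt).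
  by split=> [[Ua [_ Va]]//|[Ua Va]]; do !split=> //.
move=> /(filter_meetE F_max)[/sU[a sa] Ft].
by exists a; apply/(filter_eq_meetE F_max).
Qed.

Lemma agrees_diff U V s t : agrees_at_filter U s -> agrees_at_filter V t ->
  agrees_at_filter (omega_diff U V) (s ∖ t).
Proof.
move=> Us Vt; have [UO UE sU] := Us; split=> [w [/UO]//|a|].
  rewrite (filter_eq_diffE F_max) -UE -(agrees_image Vt).
  by split=> [[Ua [_ Va]]//|[Ua Va]]; do !split=> //.
move=> /(filter_diffE F_max)[/sU[a sa] Ft].
by exists a; apply/(filter_eq_diffE F_max).
Qed.

Lemma agrees_join U V s t : agrees_at_filter U s -> agrees_at_filter V t ->
  agrees_at_filter (omega_join U V) (s ∨ t).
Proof.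
move=> Us Vt; have [DO DE dD] := agrees_diff Us Vt; have [VO VE tV] := Vt.
have joinE z : filter_eq F z (s ∨ t) <->
    filter_eq F z (s ∖ t) \/ filter_eq F z t.
  by rewrite (filter_eq_joinE F_max) (filter_eq_diffE F_max).
split=> [w [/DO|/VO]//|a|Fst].
  by rewrite joinE -DE -VE.
have [/tV[a ta]|nFt] := EM (F t); first by exists a; apply/joinE; right.
have [Fs|//] := (filter_joinE F_max s t).1 Fst.
have [|a da] := dD; first by apply/(filter_diffE F_max).
by exists a; apply/joinE; left.
Qed.

Lemma agrees_cap U V s t : agrees_at_filter U s -> agrees_at_filter V t ->
  agrees_at_filter (U `&` V) (s ⊓ t).
Proof.
move=> [UO UE sU] [_ VE _]; split=> [w [/UO]//|a|].
  by rewrite (filter_eq_capE F_max) -UE -VE.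
move=> /(filter_capE F_max) st.
have [a sa] := sU (filter_eq_mem F_max st).
exists a; apply/(filter_eq_capE F_max); split=> //.
exact: filter_eq_trans sa st.
Qed.

Lemma agrees_zero : agrees_at_filter set0 Defs.zero.
Proof.
have F0 := filter_zero F_max.
by split=> // a; split=> // /(filter_eq_memr F_max).
Qed.

(** Some [g a] is identified with [s]; the block of [a] then belongs to [U], so [g a] is identified
    with [t] as well. *)
Lemma agrees_eq U s t : agrees_at_filter U s -> agrees_at_filter U t ->
  F s -> filter_eq F s t.
Proof.
move=> [_ sE Us] [_ tE _] /Us[a sa].
by apply: (filter_eq_trans F_max (filter_eq_sym sa)); apply/tE/sE.
Qed.

End Evaluation.
End LeftHandedSBIA.

(** * Extending a map on generators to a homomorphism *)

(** The subalgebra of the product of [S] and [T] generated by the pairs [(s a, t a)]. When it is the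
    graph of a function, that function is the wanted homomorphism. *)
Inductive hom_graph {S T : algebra} {J : Type} (s : J -> S) (t : J -> T) :
    S -> T -> Prop :=
  | graph_gen a : hom_graph s t (s a) (t a)
  | graph_meet x y x' y' : hom_graph s t x x' -> hom_graph s t y y' ->
      hom_graph s t (x ∧ y) (x' ∧ y')
  | graph_join x y x' y' : hom_graph s t x x' -> hom_graph s t y y' ->
      hom_graph s t (x ∨ y) (x' ∨ y')
  | graph_diff x y x' y' : hom_graph s t x x' -> hom_graph s t y y' ->
      hom_graph s t (x ∖ y) (x' ∖ y')
  | graph_cap x y x' y' : hom_graph s t x x' -> hom_graph s t y y' ->
      hom_graph s t (x ⊓ y) (x' ⊓ y')
  | graph_zero : hom_graph s t Defs.zero Defs.zero.

Lemma hom_graph_total {S T : algebra} {J : Type} (s : J -> S) (t : J -> T) x :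
  generated (range s) x -> exists y, hom_graph s t x y.
Proof.
move=> sx; suff : generated (range s) `<=` [set z | exists y, hom_graph s t z y].
  exact.
apply: smallest_sub => [|_ [a _ <-]]; last by exists (t a); exact: graph_gen.
split=> [y z [y' yy'] [z' zz']|y z [y' yy'] [z' zz']|y z [y' yy'] [z' zz']
  |y z [y' yy'] [z' zz']|].
- by exists (y' ∧ z'); exact: graph_meet.
- by exists (y' ∨ z'); exact: graph_join.
- by exists (y' ∖ z'); exact: graph_diff.
- by exists (y' ⊓ z'); exact: graph_cap.
- by exists Defs.zero; exact: graph_zero.
Qed.

(** By induction on the graph, [t] and [t'] both agree with the section [u] at every maximal filter,
    so no maximal filter separates them. *)
Lemma hom_graph_functional {X : Type} {T : algebra} (g : X -> T) u t t' :
  left_handed_SBIA T -> hom_graph (@i X) g u t -> hom_graph (@i X) g u t' ->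
  t = t'.
Proof.
move=> T_SBIA ut ut'; apply: (maximal_filter_separates T_SBIA) => F F_max.
have agrees v s : hom_graph (@i X) g v s ->
    agrees_at_filter g F (val (v : set_type (section_set X))) s.
  elim=> [a|v1 v2 s1 s2 _ + _|v1 v2 s1 s2 _ + _|v1 v2 s1 s2 _ + _
    |v1 v2 s1 s2 _ + _|].
  - exact: agrees_i.
  - exact: agrees_meet.
  - exact: agrees_join.
  - exact: agrees_diff.
  - exact: agrees_cap.
  - exact: agrees_zero.
by split; apply: (agrees_eq T_SBIA F_max); apply: agrees; eassumption.
Qed.

(** The equalizer of two homomorphisms is a subalgebra. *)
Lemma is_hom_eq_generated {S T : algebra} (G : set S) (h h' : S -> T) :
  is_hom h -> is_hom h' -> {in G, h =1 h'} ->
  forall x, generated G x -> h x = h' x.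
Proof.
move=> H H' hh'; apply: smallest_sub => [|x Gx]; last by apply: hh'; rewrite inE.
split=> [x y xE yE|x y xE yE|x y xE yE|x y xE yE|] /=.
- by rewrite (hom_meet H) (hom_meet H') xE yE.
- by rewrite (hom_join H) (hom_join H') xE yE.
- by rewrite (hom_diff H) (hom_diff H') xE yE.
- by rewrite (hom_cap H) (hom_cap H') xE yE.
- by rewrite (hom_zero H) (hom_zero H').
Qed.

(** * Subalgebras and their generators *)

Section Subalgebra.
Variables (S : algebra) (B : set S) (HB : subalgebra B).

Lemma subalg_SBIA : left_handed_SBIA S -> left_handed_SBIA (subalg HB).
Proof.
move=> [S_SBA [lhm lhj] S_cap].
(* The natural order is defined by equations, so it restricts to the subalgebra, and the inherited
   [⊓] remains a greatest lower bound there. *)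
have leE (u v : subalg HB) :
    natural_le u v <-> natural_le (val u : S) (val v : S).
  by split=> [[/(congr1 val) uv /(congr1 val) vu]|[uv vu]]; split=> //;
    exact: val_inj.
split.
- split=> *; apply: val_inj => /=.
  + exact: meetA.
  + exact: joinA.
  + exact: joinKl.
  + exact: joinKr.
  + exact: meetKl.
  + exact: meetKr.
  + exact: meet_joinr.
  + exact: meet_joinl.
  + exact: join_zero.
  + exact: zero_join.
  + exact: meet_zero.
  + exact: zero_meet.
  + exact: diff_meet.
  + exact: meet_diff.
  + exact: diff_join.
  + exact: join_diff.
  + exact: meet_normal.
- by split=> *; apply: val_inj => /=; [exact: lhm | exact: lhj].
- move=> u v; have [lu lv glb] := S_cap (val u) (val v).
  by split=> [||w /leE wu /leE wv]; apply/leE => //; exact: glb.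
Qed.

End Subalgebra.

Lemma generated_subalgT {S : algebra} (G : set S) :
  generated ([set u | G (val u)] : set (subalg (generated_subalgebra G))) = setT.
Proof.
apply/seteqP; split=> // u _ C [C_sub GC].
(* It suffices that the image of [C] in [S], a subalgebra containing [G], contains all of
   [generated G]. *)
have [v Cv /val_inj<-//] : (val @` C) (val u); last first.
have : generated G (val u) by exact: set_valP.
apply: smallest_sub (val u) => [|x Gx].
  split=> [_ _ [x Cx <-] [y Cy <-]|_ _ [x Cx <-] [y Cy <-]
    |_ _ [x Cx <-] [y Cy <-]|_ _ [x Cx <-] [y Cy <-]|].
  - by exists (x ∧ y) => //; exact: sub_meet.
  - by exists (x ∨ y) => //; exact: sub_join.
  - by exists (x ∖ y) => //; exact: sub_diff.
  - by exists (x ⊓ y) => //; exact: sub_cap.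
  - by exists Defs.zero => //; exact: sub_zero.
have Gx' : generated G x by exact: sub_smallest Gx.
by exists (SigSub (mem_set Gx')) => //; exact: GC.
Qed.

(** * [S_Omega] is a left-handed SBIA *)

Section SOmega.
Variable X : Type.
Implicit Types (U V W : set (set (set X) * set X)).

Lemma image_meetE U V a :
  (@p X @` omega_meet U V) a = ((@p X @` U) a /\ (@p X @` V) a).
Proof.
apply/propext; split=> [[w [Uw [Up Vp]] <-]//|[[w Uw <-] Vp]].
by exists w => //; split=> //; split=> //; exists w.
Qed.

Lemma image_diffE U V a :
  (@p X @` omega_diff U V) a = ((@p X @` U) a /\ ~ (@p X @` V) a).
Proof.
apply/propext; split=> [[w [Uw [Up Vp]] <-]//|[[w Uw <-] Vp]].
by exists w => //; split=> //; split=> //; exists w.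
Qed.

Lemma image_joinE U V a :
  (@p X @` omega_join U V) a = ((@p X @` U) a \/ (@p X @` V) a).
Proof.
rewrite /omega_join image_setU /setU /mkset image_diffE.
by apply/propext; have := EM ((@p X @` V) a); tauto.
Qed.

Lemma mem_meetE U V w : omega_meet U V w = (U w /\ (@p X @` V) (p w)).
Proof.
by apply/propext; split=> [[Uw []]//|[Uw Vw]]; do !split=> //; exists w.
Qed.

Lemma mem_diffE U V w : omega_diff U V w = (U w /\ ~ (@p X @` V) (p w)).
Proof.
by apply/propext; split=> [[Uw []]//|[Uw Vw]]; do !split=> //; exists w.
Qed.

Lemma mem_joinE U V w :
  omega_join U V w = ((U w /\ ~ (@p X @` V) (p w)) \/ V w).
Proof. by rewrite /omega_join /setU /mkset mem_diffE. Qed.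

Let omegaE := (mem_joinE, mem_meetE, mem_diffE, image_joinE, image_meetE,
  image_diffE, @image_set0).

(** Combines excluded middle for the image with the one link between the two kinds of atoms: [U w]
    implies that [p w] is in the image. This is all that [tauto] needs in order to decide the
    identities. *)
Lemma mem_image_cases U w :
  (@p X @` U) (p w) \/ ~ (@p X @` U) (p w) /\ ~ U w.
Proof.
have [Up|nUp] := EM ((@p X @` U) (p w)); [by left | right].
by split=> // Uw; apply: nUp; exists w.
Qed.

(* At a point [w], membership in a compound set is a Boolean combination of the
   membership of [w] in its components and of [p w] in their images, so that
   identities between sections are propositional tautologies. *)
Local Ltac section_identity :=
  let w := fresh "w" in
  apply: val_inj => /=; apply/funext; intro w; rewrite ?omegaE; apply/propext;
  repeat match goal with u : carrier (S_Omega X) |- _ =>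
    generalize (mem_image_cases (sval u) w); generalize (sval u); clear u; intro
  end; rewrite /set0 /mkset; tauto.

Lemma S_Omega_skew_boolean : skew_boolean (S_Omega X).
Proof. split=> *; section_identity. Qed.

Lemma S_Omega_left_handed : left_handed (S_Omega X).
Proof. split=> *; section_identity. Qed.

Lemma S_Omega_le (u v : S_Omega X) :
  natural_le u v <->
  (val (u : set_type (section_set X)) `<=` val (v : set_type (section_set X))).
Proof.
split=> [[_ /(congr1 val) /= vu] w|uv].
  by rewrite -[X in X w]vu => -[].
have [_ v_inj] := set_valP v.
split; apply: val_inj; apply/funext => w /=; rewrite omegaE; apply/propext.
  by split=> [[]//|uw]; split=> //; exists w => //; exact: uv.
split=> [[vw [w' uw' ww']]|uw]; last by split; [exact: uv | exists w].
(* Both [w] and [w'] lie in [v] over the same point, so injectivity of [p] on [v] makes them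
   equal. *)
by rewrite -(v_inj w' w) ?inE //; exact: uv.
Qed.

Lemma S_Omega_SBIA : left_handed_SBIA (S_Omega X).
Proof.
split; [exact: S_Omega_skew_boolean | exact: S_Omega_left_handed |].
move=> u v; split=> [||z /S_Omega_le zu /S_Omega_le zv]; apply/S_Omega_le.
- by move=> w [].
- by move=> w [].
- by move=> w zw; split; [exact: zu | exact: zv].
Qed.

End SOmega.

(** * Freeness of [S_X] *)

Theorem theorem34 (X : Type) (X_infinite : infinite_set [set: X]) :
  freely_generated left_handed_SBIA (F := S_X X) (Xbar_in_S_X X).
Proof.
split; [exact/subalg_SBIA/S_Omega_SBIA | exact: generated_subalgT |].
move=> T T_SBIA f.
have gen_i a : generated (Xbar X) (i a) by move=> B [_]; apply; exists a.
pose i' a : S_X X := SigSub (mem_set (gen_i a)).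
have Xbar_i a : Xbar_in_S_X X (i' a) by exists a.
(* [f] reindexed by [X], which turns it into a family to which evaluation at maximal filters
   applies. *)
pose g a := f (SigSub (mem_set (Xbar_i a))).
pose graph (u : S_X X) := hom_graph (@i X) g (val u).
have /choice[h hP] (u : S_X X) : exists t, graph u t.
  exact/hom_graph_total/set_valP.
(* Since the graph is functional, each homomorphism law of [h] reduces to one closure rule of
   [hom_graph]. *)
have h_eq u t : graph u t -> h u = t by apply: hom_graph_functional (hP u).
have h_hom : is_hom h.
  split=> [u v|u v|u v|u v|]; apply: h_eq.
  - exact: graph_meet (hP u) (hP v).
  - exact: graph_join (hP u) (hP v).
  - exact: graph_diff (hP u) (hP v).
  - exact: graph_cap (hP u) (hP v).
  - exact: graph_zero.
have hf (u : set_type (Xbar_in_S_X X)) : h (val u) = f u.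
  have [a _ ai] := set_valP u; have -> : u = SigSub (mem_set (Xbar_i a)).
    (* One [val_inj] leads from the generating set to [S_X], the other from [S_X] to [S_Omega]. *)
    by do 2![apply: val_inj]; rewrite -ai.
  by apply: h_eq; exact: graph_gen.
exists h; split=> // h' [h'_hom h'f]; apply/funext => u.
apply: (is_hom_eq_generated (G := Xbar_in_S_X X) h_hom h'_hom).
  by move=> v vX; rewrite (hf (SigSub vX)) -h'f.
by rewrite generated_subalgT.
Qed.
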